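(* Let $N,n\ge0$ be integers. Let $U_N(n)$ be the number of partitions $\pi=(\lambda_1,\lambda_2,\dots)$ with $\mathcal{O}(\pi)=n$ and $\lambda_1\le N$. Let $T_N(n)$ be the number of 2-color partitions (red and green) of $n$ such that the number of red parts plus the size of the largest green part does not exceed $N$. Then $U_N(n)=T_N(n)$.
   Context: A partition is a finite non-increasing sequence of positive integers; the empty sequence is the unique partition of $0$. $\mathcal{O}(\pi)=\lambda_1+\lambda_3+\lambda_5+\cdots$. In a 2-color partition each part is colored red or green; partitions differing in the coloring are distinct. If there are no green parts the size of the largest green part is taken to be $0$. *)

(* Defs.v *)
From mathcomp Require Import all_boot finmap.
From mathcomp Require Import classical_sets cardinality.

Set Implicit Arguments.
Unset Strict Implicit.
Unset Printing Implicit Defensive.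

Local Open Scope classical_set_scope.

Definition is_partition (pi : seq nat) : bool :=
  sorted geq pi && (0 \notin pi).

(* The parts lambda_1, lambda_3, ... have even index, as [nth] counts from 0. *)
Definition odd_index_sum (pi : seq nat) : nat :=
  \sum_(i < size pi | ~~ odd i) nth 0 pi i.

(* A colored part is (size, color), with color [true] = red, [false] = green. *)
Notation cpart := (nat * bool)%type.

(* The order of differently colored parts of the same size is immaterial: such
   parts are listed red first, so that each 2-color partition has exactly one
   representation as a sequence. *)
Definition cpart_geq (p q : cpart) : bool :=
  (q.1 < p.1) || ((q.1 == p.1) && (q.2 ==> p.2)).

Definition is_2color_partition (pi : seq cpart) : bool :=
  sorted cpart_geq pi && all (fun p : cpart => 0 < p.1) pi.

Definition csize (pi : seq cpart) : nat := \sum_(p <- pi) p.1.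

Definition red_count (pi : seq cpart) : nat := count (fun p : cpart => p.2) pi.

Definition largest_green (pi : seq cpart) : nat :=
  \max_(p <- pi | ~~ p.2) p.1.

Definition U_set (N n : nat) : set (seq nat) :=
  [set pi | [/\ is_partition pi, odd_index_sum pi = n & head 0 pi <= N]].

Definition T_set (N n : nat) : set (seq cpart) :=
  [set pi | [/\ is_2color_partition pi, csize pi = n
              & red_count pi + largest_green pi <= N]].

(* [fset_set] is meaningful on finite sets only; see [U_set_finite] and
   [T_set_finite]. *)
Definition U (N n : nat) : nat := #|` fset_set (U_set N n)|.

Definition T (N n : nat) : nat := #|` fset_set (T_set N n)|.

Lemma finite_bounded_seq (X : choiceType) (r : seq X) (k : nat) (A : set (seq X)) :
  (forall s, A s -> {subset s <= r} /\ size s <= k) -> finite_set A.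
Proof.
move=> HA.
apply: (@sub_finite_set _ _
  ((fun t : k.-bseq (seq_sub r) => map val t) @` setT)); last first.
  by apply: finite_image; exact: finite_finset.
move=> s /HA[sr sk].
have E : map val (pmap (insub : X -> option (seq_sub r)) s) = s.
  rewrite pmap_filter; last by move=> x /=; case: insubP.
  by apply/all_filterP/allP => x /sr; rewrite isSome_insub.
have Hsz : size (pmap (insub : X -> option (seq_sub r)) s) <= k.
  by rewrite -(size_map val) E.
by exists (Bseq Hsz).
Qed.

Lemma size_le_odd_index_sum (pi : seq nat) :
  0 \notin pi -> size pi <= (odd_index_sum pi).*2.
Proof.
have [m] := ubnP (size pi); elim: m pi => // m IH [|a [|b s]] //= sm.
  rewrite inE /odd_index_sum /= big_mkcond big_ord_recl /= eq_sym -lt0n.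
  by case: a {sm} => // a _; rewrite addSn doubleS.
rewrite !inE !negb_or !(eq_sym 0) -!lt0n => /and3P[a0 _ s0].
have -> : odd_index_sum [:: a, b & s] = a + odd_index_sum s.
  rewrite /odd_index_sum /= [LHS]big_mkcond [in RHS]big_mkcond.
  rewrite !big_ord_recl /= add0n; congr (_ + _).
  by apply: eq_bigr => i _; rewrite /= negbK.
have := IH s (ltn_trans (ltnSn _) sm) s0.
by case: a a0 {sm} => // a _ H; rewrite doubleD doubleS !addSn !ltnS (leq_trans H) ?leq_addl.
Qed.

Lemma U_set_finite (N n : nat) : finite_set (U_set N n).
Proof.
apply: (@finite_bounded_seq _ (iota 0 N.+1) n.*2) => s [/andP[ss s0] sn sN].
split; last by rewrite -sn size_le_odd_index_sum.
move=> x xs; rewrite mem_iota /= add0n ltnS; apply: leq_trans sN.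
case: s ss xs {s0 sn} => //= a s /(order_path_min _) Ha.
rewrite inE => /orP[/eqP-> //|xs].
apply: (allP (Ha _)) => // u v w uv vw; exact: leq_trans vw uv.
Qed.

Lemma T_set_finite (N n : nat) : finite_set (T_set N n).
Proof.
apply: (@finite_bounded_seq _
  [seq (i, c) | i <- iota 0 n.+1, c <- [:: true; false]] n).
move=> s [/andP[_ s0] sn _]; split.
  move=> [i c] xs; apply: allpairs_f; last by case: c {xs}.
  rewrite mem_iota /= add0n ltnS -sn /csize (perm_big _ (perm_to_rem xs)) /=.
  by rewrite big_cons leq_addr.
rewrite -sn /csize -sum1_size big_seq [leqRHS]big_seq.
by apply: leq_sum => p /(allP s0).
Qed.

(* Main.v *)
Require Import Defs.
From mathcomp Require Import all_boot.
From mathcomp Require Import finmap zify.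
From mathcomp Require Import classical_sets cardinality.

Set Implicit Arguments.
Unset Strict Implicit.
Unset Printing Implicit Defensive.

(** A 2-color partition is encoded by the conjugate [r_0 >= r_1 >= ...] of its
    red part and by its green parts [g_0 >= g_1 >= ...].  The bijection
    interleaves these two sequences into the partition
      [(r_0 + g_0, r_1 + g_0, r_1 + g_1, r_2 + g_1, r_2 + g_2, ...)].
    Its first part is [r_0 + g_0], the number of red parts plus the largest green
    part; its parts [r_k + g_k] add up to the size of the 2-color partition.
    Conversely [r_k - r_(k+1)] and [g_k - g_(k+1)] are differences of consecutive
    parts, and [r], [g] vanish eventually, so both are recovered by summation. *)

(** * Non-increasing sequences of naturals, their entries and sums *)

Lemma geq_trans : transitive geq.
Proof. by move=> x y z xy yz; apply: leq_trans yz xy. Qed.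

Lemma sorted_geq_nth_le (s : seq nat) (i : nat) :
  sorted geq s -> nth 0 s i.+1 <= nth 0 s i.
Proof.
elim: s i => [|a [|b s] IH] [|i] //=.
  by case/andP.
by case/andP=> _ /IH; apply.
Qed.

Lemma sorted_geq_mkseq (f : nat -> nat) (m : nat) :
  (forall i, f i.+1 <= f i) -> sorted geq (mkseq f m).
Proof.
move=> f_le; apply: (@homo_sorted _ _ f ltn geq); last exact: iota_ltn_sorted.
move=> i j /=; elim: j => // j IH; rewrite ltnS leq_eqVlt => /orP[/eqP->|/IH].
  exact: f_le.
exact: leq_trans (f_le j).
Qed.

(** The zeros of a non-increasing sequence form a final segment, and the default value of [nth]
    stands in for them once they are removed. *)
Lemma nth_filter_pos (s : seq nat) (i : nat) :
  sorted geq s -> nth 0 [seq x <- s | 0 < x] i = nth 0 s i.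
Proof.
elim: s i => [|a s IH] i //= Hs.
case: posnP => [a0|_]; last first.
  by case: i => //= i; apply: IH; apply: path_sorted Hs.
have s0 : all (fun x => x == 0) s.
  by apply: sub_all (order_path_min geq_trans Hs) => x /=; rewrite a0 leqn0.
have -> : [seq x <- s | 0 < x] = [::].
  apply/eqP; rewrite -(negbK (_ == _)) -has_filter; apply/hasPn => x /(allP s0).
  by move/eqP->.
rewrite nth_nil a0; case: i => //= i; case: (ltnP i (size s)) => Hi.
  by apply/esym/eqP/(allP s0)/mem_nth.
by rewrite nth_default.
Qed.

Lemma eq_nth0_pos (s t : seq nat) :
  0 \notin s -> 0 \notin t -> nth 0 s =1 nth 0 t -> s = t.
Proof.
suff le_size (u v : seq nat) :
    0 \notin v -> nth 0 u =1 nth 0 v -> size v <= size u.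
  move=> s0 t0 Est; apply: (@eq_from_nth _ 0) => [|i _]; last exact: Est.
  by apply/eqP; rewrite eqn_leq !le_size.
(* If [v] were longer, its entry at index [size u] would equal the default 0 read from [u]. *)
move=> v0 Euv; rewrite leqNgt; apply: contra v0 => lt_uv.
by rewrite -(nth_default 0 (leqnn (size u))) Euv mem_nth.
Qed.

Lemma odd_index_sum_cons2 (a b : nat) (s : seq nat) :
  odd_index_sum [:: a, b & s] = a + odd_index_sum s.
Proof.
rewrite /odd_index_sum /= [LHS]big_mkcond [in RHS]big_mkcond.
rewrite !big_ord_recl /= add0n; congr (_ + _).
by apply: eq_bigr => i _; rewrite /= negbK.
Qed.

Lemma odd_index_sumE (s : seq nat) (m : nat) :
  size s <= m.*2 -> odd_index_sum s = \sum_(k < m) nth 0 s k.*2.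
Proof.
elim: m s => [|m IH] [|a [|b s]] //=.
- by rewrite /odd_index_sum !big_ord0.
- by move=> _; rewrite /odd_index_sum big_ord0 big1 // => i _; rewrite nth_nil.
- by move=> _; rewrite /odd_index_sum big_mkcond !big_ord_recl /= big_ord0 big1.
rewrite doubleS !ltnS => /IH Hs.
by rewrite odd_index_sum_cons2 Hs big_ord_recl.
Qed.

Lemma sum_nth0 (s : seq nat) (m : nat) :
  size s <= m -> \sum_(k < m) nth 0 s k = sumn s.
Proof.
elim: s m => [|a s IH] [|m] //=; rewrite ?big_ord0 //.
  by move=> _; rewrite big1 // => i _; rewrite nth_nil.
by rewrite ltnS => /IH Hs; rewrite big_ord_recl /= Hs.
Qed.

(** A single part [x] adds 1 to each of the first [x] entries of the conjugate. *)
Lemma sum_ltn (x m : nat) : x <= m -> \sum_(k < m) (k < x) = x.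
Proof.
elim: m x => [|m IH] [|x]; rewrite ?big_ord0 //.
  by rewrite big1.
by rewrite ltnS => /IH Hx; rewrite big_ord_recl /= -[in RHS]Hx.
Qed.

(** * Colored parts and the interleaving map *)

Lemma cpart_geq_trans : transitive cpart_geq.
Proof.
by move=> [y c] [x b] [z d]; rewrite /cpart_geq /=; case: b c d => [] [] [] /=; lia.
Qed.

Lemma cpart_geq_total : total cpart_geq.
Proof. by move=> [x b] [y c]; rewrite /cpart_geq /=; case: b c => [] [] /=; lia. Qed.

Lemma cpart_geq_anti : antisymmetric cpart_geq.
Proof.
move=> [x b] [y c]; rewrite /cpart_geq /= => H.
have -> : x = y by case: b c H => [] [] /=; lia.
by congr (_, _); case: b c H => [] [] //=; lia.
Qed.

(** This is the entry [r_k] of the conjugate of the red part, indexed from 0. *)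
Definition red_tail (pi : seq cpart) (k : nat) : nat :=
  count (fun p : cpart => p.2 && (k < p.1)) pi.

Definition greens (pi : seq cpart) : seq nat :=
  [seq p.1 | p <- pi & ~~ p.2].

Definition interleave_nth (pi : seq cpart) (i : nat) : nat :=
  red_tail pi (uphalf i) + nth 0 (greens pi) i./2.

(* The length is only an upper bound for the number of nonzero entries. *)
Definition interleave (pi : seq cpart) : seq nat :=
  [seq x <- mkseq (interleave_nth pi) (csize pi + size pi).*2 | 0 < x].

Lemma size_greens (pi : seq cpart) : size (greens pi) <= size pi.
Proof. by rewrite size_map size_filter count_size. Qed.

Lemma greens_sorted (pi : seq cpart) :
  sorted cpart_geq pi -> sorted geq (greens pi).
Proof.
move=> Hpi; apply: (@homo_sorted _ _ _ cpart_geq); last first.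
  exact: sorted_filter cpart_geq_trans _ _ Hpi.
by move=> [x b] [y c]; rewrite /cpart_geq /=; lia.
Qed.

Lemma zero_notin_greens (pi : seq cpart) :
  is_2color_partition pi -> 0 \notin greens pi.
Proof.
case/andP=> _ /allP pos; apply/negP => /mapP[p].
by rewrite mem_filter => /andP[_ /pos]; case: p.1.
Qed.

Lemma part_le_csize (pi : seq cpart) (p : cpart) : p \in pi -> p.1 <= csize pi.
Proof.
by move=> Hp; rewrite /csize (perm_big _ (perm_to_rem Hp)) big_cons leq_addr.
Qed.

Lemma red_tail_eq0 (pi : seq cpart) (k : nat) :
  csize pi <= k -> red_tail pi k = 0.
Proof.
move=> Hk; apply/eqP; rewrite eqn0Ngt -has_count; apply/hasPn => p.
by move/part_le_csize/leq_trans => /(_ _ Hk) Hp; rewrite negb_and -leqNgt Hp orbT.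
Qed.

Lemma red_tail_le (pi : seq cpart) (k : nat) :
  red_tail pi k.+1 <= red_tail pi k.
Proof. by apply: sub_count => p /andP[-> /ltnW]. Qed.

Lemma red_tail0 (pi : seq cpart) :
  is_2color_partition pi -> red_tail pi 0 = red_count pi.
Proof.
by case/andP=> _ /allP pos; apply: eq_in_count => p /pos ->; rewrite andbT.
Qed.

Lemma nth_greens0 (pi : seq cpart) :
  sorted cpart_geq pi -> nth 0 (greens pi) 0 = largest_green pi.
Proof.
move/greens_sorted; rewrite /largest_green -big_filter -(big_map fst xpredT id).
rewrite -/(greens pi); case: (greens pi) => [|a s] /= Hs; first by rewrite big_nil.
rewrite big_cons; apply/esym/maxn_idPl/bigmax_leqP_seq => x xs _.
exact: (allP (order_path_min geq_trans Hs)).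
Qed.

(** Double counting of the red diagram by rows and by columns; since no part exceeds [m], no column
    is cut off. *)
Lemma csize_red_tail_greens (pi : seq cpart) (m : nat) : csize pi <= m ->
  csize pi = \sum_(k < m) red_tail pi k + sumn (greens pi).
Proof.
rewrite /csize /red_tail /greens.
elim: pi => [|[x c] pi IH]; first by rewrite big_nil addn0 big1.
rewrite big_cons => Hm.
have {}IH := IH (leq_trans (leq_addl _ _) Hm).
have Hx : x <= m by apply: leq_trans Hm; rewrite leq_addr.
rewrite {}[in LHS]IH /=; case: c {Hm} => /=.
  by rewrite big_split /= sum_ltn // addnA.
by rewrite addnCA.
Qed.

Lemma interleave_nth_le (pi : seq cpart) (i : nat) : sorted cpart_geq pi ->
  interleave_nth pi i.+1 <= interleave_nth pi i.
Proof.
move/greens_sorted => Hg; rewrite /interleave_nth.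
(* Each step advances exactly one of the two indices: the green one for odd [i], the red one for
   even [i]. *)
have [[E1 E2]|[E1 E2]] : (uphalf i.+1 = uphalf i /\ i.+1./2 = i./2.+1) \/
    (uphalf i.+1 = (uphalf i).+1 /\ i.+1./2 = i./2).
- by lia.
- by rewrite E1 E2 leq_add2l sorted_geq_nth_le.
- by rewrite E1 E2 leq_add2r red_tail_le.
Qed.

Lemma nth_interleave (pi : seq cpart) (i : nat) : sorted cpart_geq pi ->
  nth 0 (interleave pi) i = interleave_nth pi i.
Proof.
move=> Hpi; rewrite nth_filter_pos; last first.
  by apply: sorted_geq_mkseq => j; apply: interleave_nth_le.
case: (ltnP i (csize pi + size pi).*2) => Hi; first by rewrite nth_mkseq.
rewrite nth_default ?size_mkseq // /interleave_nth red_tail_eq0; last by lia.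
by rewrite nth_default // (leq_trans (size_greens _)) //; lia.
Qed.

Lemma interleave_is_partition (pi : seq cpart) :
  sorted cpart_geq pi -> is_partition (interleave pi).
Proof.
move=> Hpi; rewrite /is_partition mem_filter /= andbT.
apply: sorted_filter; first exact: geq_trans.
by apply: sorted_geq_mkseq => j; apply: interleave_nth_le.
Qed.

Lemma head_interleave (pi : seq cpart) : is_2color_partition pi ->
  head 0 (interleave pi) = red_count pi + largest_green pi.
Proof.
move=> Hpi; have /andP[Hs _] := Hpi.
by rewrite -nth0 nth_interleave // /interleave_nth red_tail0 // nth_greens0.
Qed.

Lemma odd_index_sum_interleave (pi : seq cpart) :
  sorted cpart_geq pi -> odd_index_sum (interleave pi) = csize pi.
Proof.
move=> Hpi; set m := csize pi + size pi.
rewrite (@odd_index_sumE _ m); last first.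
  by rewrite size_filter (leq_trans (count_size _ _)) // size_mkseq.
rewrite [RHS](@csize_red_tail_greens _ m) ?leq_addr //.
rewrite -(@sum_nth0 _ m); last by rewrite (leq_trans (size_greens _)) // leq_addl.
rewrite -big_split; apply: eq_bigr => k _.
by rewrite nth_interleave // /interleave_nth uphalf_double doubleK.
Qed.

(** * Injectivity of the interleaving *)

Lemma interleave_inj (pi1 pi2 : seq cpart) :
  is_2color_partition pi1 -> is_2color_partition pi2 ->
  interleave pi1 = interleave pi2 -> pi1 = pi2.
Proof.
move=> H1 H2 E12.
have [/andP[S1 P1] /andP[S2 P2]] := (H1, H2).
have E i : interleave_nth pi1 i = interleave_nth pi2 i.
  by rewrite -!nth_interleave // E12.
have Eeven k : red_tail pi1 k + nth 0 (greens pi1) k =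
               red_tail pi2 k + nth 0 (greens pi2) k.
  by have := E k.*2; rewrite /interleave_nth uphalf_double doubleK.
have Eodd k : red_tail pi1 k.+1 + nth 0 (greens pi1) k =
              red_tail pi2 k.+1 + nth 0 (greens pi2) k.
  by have := E k.*2.+1; rewrite /interleave_nth /= doubleK uphalf_double.
(* Descending induction from indices where both sides vanish: [Eeven] and [Eodd] differ by
   [r_k - r_(k+1)], so agreement at [k.+1] passes to [k]. *)
have Er k : red_tail pi1 k = red_tail pi2 k.
  have [j] : exists j, csize pi1 + csize pi2 <= k + j.
    by exists (csize pi1 + csize pi2); rewrite leq_addl.
  elim: j k => [|j IH] k Hj; first by rewrite !red_tail_eq0 //; lia.
  have := IH k.+1; rewrite addSnnS => /(_ Hj); have := Eeven k; have := Eodd k.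
  by lia.
have Eg : greens pi1 = greens pi2.
  apply: eq_nth0_pos; rewrite ?zero_notin_greens // => k.
  by have := Eeven k; rewrite Er => /addnI.
(* Both sequences are sorted for an antisymmetric order, so comparing multiplicities suffices. *)
apply: (sorted_eq cpart_geq_trans cpart_geq_anti) => //.
have count0 b pi : all (fun p : cpart => 0 < p.1) pi -> count_mem (0, b) pi = 0.
  by move=> /allP Hpi; apply/count_memPn/negP => /Hpi.
(* The multiplicity of a red part is a difference of consecutive conjugate entries. *)
have count_red k pi : red_tail pi k = count_mem (k.+1, true) pi + red_tail pi k.+1.
  rewrite /red_tail; elim: pi => //= -[x b] pi ->; rewrite xpair_eqE /=.
  by case: b => /=; lia.
have count_green k pi : count_mem (k, false) pi = count_mem k (greens pi).
  rewrite count_map count_filter; apply: eq_count => -[x b] /=.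
  by rewrite xpair_eqE; case: b.
apply/allP => -[k b] _ /=; apply/eqP; case: b; last by rewrite !count_green Eg.
case: k => [|k]; first by rewrite !count0.
by apply: (@addIn (red_tail pi1 k.+1)); rewrite -count_red (Er k.+1) -count_red.
Qed.

(** * Surjectivity of the interleaving *)

(** Along the chain [a_k >= b_k >= a_(k+1) >= ...] truncated subtraction is exact, and the
    differences telescope down to the zero tail. *)
Lemma telescope_pairs (a b : nat -> nat) (m k : nat) :
  (forall j, b j <= a j) -> (forall j, a j.+1 <= b j) ->
  (forall j, m <= j -> a j = 0) ->
  \sum_(k <= j < m) (a j - b j) + \sum_(k <= j < m) (b j - a j.+1) = a k.
Proof.
move=> Hab Hba Hm; rewrite -big_split /=.
have [i] : exists i, m <= k + i by exists m; rewrite leq_addl.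
elim: i k => [|i IH] k Hi.
  by rewrite addn0 in Hi; rewrite big_geq // Hm.
case: (leqP m k) => Hk; first by rewrite big_geq // Hm.
rewrite big_ltn // IH; last by rewrite addSnnS.
by have := Hab k; have := Hba k; lia.
Qed.

Lemma ex_2color_partition (c g : nat -> nat) (m : nat) :
  (forall k, g k.+1 <= g k) -> (forall k, m <= k -> g k = 0) ->
  exists pi, [/\ is_2color_partition pi,
    forall k, red_tail pi k = \sum_(k <= j < m) c j
    & forall k, nth 0 (greens pi) k = g k].
Proof.
move=> g_le g0.
(* With [c j] red parts of size [j.+1], each counted in [r_k] exactly when [k <= j], the conjugate
   becomes a tail sum of [c]. *)
pose reds := flatten [seq nseq (c j) j.+1 | j <- iota 0 m].
pose grs := [seq x <- mkseq g m | 0 < x].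
pose pi : seq cpart :=
  sort cpart_geq ([seq (x, true) | x <- reds] ++ [seq (x, false) | x <- grs]).
have Sg := sorted_geq_mkseq m g_le.
exists pi; split.
- apply/andP; split; first exact: (sort_sorted cpart_geq_total).
  rewrite all_sort all_cat !all_map; apply/andP; split; apply/allP => x /=.
    by case/flatten_mapP => j _ /nseqP[->].
  by rewrite mem_filter => /andP[].
- move=> k; rewrite /red_tail count_sort count_cat !count_map.
  rewrite [X in _ + X](eq_count (a2 := pred0)) // count_pred0 addn0.
  rewrite count_flatten -map_comp sumnE big_map.
  transitivity (\sum_(0 <= j < m | k <= j) c j).
    rewrite [RHS]big_mkcond /index_iota subn0; apply: eq_bigr => j _ /=.
    by rewrite count_nseq /= ltnS; case: (k <= j); rewrite ?mul1n.
  case: (leqP k m) => Hk; last first.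
    rewrite [RHS]big_geq ?(ltnW Hk) // big_seq_cond big1 // => j.
    by rewrite mem_index_iota => /andP[/andP[_ Hj]]; rewrite leqNgt (ltn_trans Hj Hk).
  rewrite (big_cat_nat (leq0n k) Hk) /= [X in X + _]big_seq_cond.
  rewrite big1 ?add0n => [|j]; last first.
    by rewrite mem_index_iota => /andP[/andP[_ Hj]]; rewrite leqNgt Hj.
  rewrite big_seq_cond [RHS]big_seq; apply: eq_bigl => j.
  by rewrite mem_index_iota; case: (k <= j); rewrite ?andbT ?andbF.
- have -> : greens pi = grs.
    rewrite /greens (filter_sort cpart_geq_total cpart_geq_trans) filter_cat.
    rewrite !filter_map (@eq_filter _ _ pred0) // filter_pred0 /=.
    rewrite (@eq_filter _ _ predT) // filter_predT sorted_sort.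
    + by rewrite -map_comp map_id.
    + exact: cpart_geq_trans.
    + apply: (@homo_sorted _ _ _ geq); last exact: sorted_filter geq_trans _ _ _.
      by move=> x y; rewrite /cpart_geq /=; lia.
  move=> k; rewrite nth_filter_pos //; case: (ltnP k m) => Hk.
    by rewrite nth_mkseq.
  by rewrite nth_default ?size_mkseq // g0.
Qed.

Lemma interleave_surj (la : seq nat) : is_partition la ->
  exists2 pi, is_2color_partition pi & interleave pi = la.
Proof.
case/andP=> Sla la0; set m := size la.
pose a k := nth 0 la k.*2; pose b k := nth 0 la k.*2.+1.
have Hab k : b k <= a k by apply: sorted_geq_nth_le.
have Hba k : a k.+1 <= b k by rewrite /a doubleS; apply: sorted_geq_nth_le.
have Ha k : m <= k -> a k = 0 by move=> Hk; rewrite /a nth_default //; lia.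
(* From [b_j = r_(j+1) + g_j] and [a_(j+1) = r_(j+1) + g_(j+1)], the summand is forced to be
   [g_j - g_(j+1)]; likewise [a_j - b_j] is [r_j - r_(j+1)]. *)
pose g k := \sum_(k <= j < m) (b j - a j.+1).
have g_rec k : k < m -> g k = b k - a k.+1 + g k.+1.
  by move=> Hk; rewrite /g big_ltn.
have g0 k : m <= k -> g k = 0 by move=> Hk; rewrite /g big_geq.
have g_le k : g k.+1 <= g k.
  by case: (ltnP k m) => Hk; [rewrite (g_rec k) // leq_addl | rewrite g0 // ltnW].
have [pi [Hpi Hr Hg]] := ex_2color_partition (fun j => a j - b j) g_le g0.
have /andP[Spi _] := Hpi.
exists pi => //; apply: eq_nth0_pos => //.
  by have /andP[] := interleave_is_partition Spi.
move=> i; rewrite nth_interleave // /interleave_nth Hr Hg.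
rewrite -[i in RHS]odd_double_half uphalf_half; case: (odd i); last first.
  by rewrite !add0n; apply: telescope_pairs.
rewrite !add1n -/(b _); set k := i./2.
(* For odd [i], telescoping from [k.+1] gives [r_(k+1) + g_(k+1) = a_(k+1)]; adding [b_k - a_(k+1)]
   turns this into [r_(k+1) + g_k = b_k]. *)
have := telescope_pairs k.+1 Hab Hba Ha; rewrite -/(g _).
case: (ltnP k m) => Hk; first by rewrite (g_rec k) //; have := Hba k; lia.
rewrite !g0 ?big_geq //; try exact: leqW.
by have := Hab k; rewrite Ha // leqn0 => /eqP ->.
Qed.

(** * Transfer of the two statistics and equality of cardinalities *)

Lemma image_interleave (N n : nat) :
  (U_set N n = [set interleave pi | pi in T_set N n])%classic.
Proof.
apply/seteqP; split=> [la [Hla Hn HN]|_ [pi [Hpi Hn HN] <-]].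
  have [pi Hpi Epi] := interleave_surj Hla; have /andP[Spi _] := Hpi.
  exists pi => //; split=> //; first by rewrite -odd_index_sum_interleave ?Epi.
  by rewrite -head_interleave ?Epi.
have /andP[Spi _] := Hpi.
split; first exact: interleave_is_partition.
  by rewrite odd_index_sum_interleave.
by rewrite head_interleave.
Qed.

Theorem theorem3p4 (N n : nat) : U N n = T N n.
Proof.
rewrite /U /T image_interleave fset_set_image; last exact: T_set_finite.
rewrite card_in_imfset // => pi1 pi2.
rewrite !in_fset_set; try exact: T_set_finite.
rewrite !inE => -[H1 _ _] [H2 _ _]; exact: interleave_inj.
Qed.
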